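(* Let $A$ be a linearly ordered po-group and let $G$ be a directed po-group. Then: (a) the (unrestricted) Wreath product $A\,\mathrm{Wr}\,G$ satisfies RDP if and only if $G$ satisfies RDP; (b) $A\,\mathrm{Wr}\,G$ satisfies RDP$_1$ if and only if $G$ satisfies RDP$_1$; (c) $A\,\mathrm{Wr}\,G$ satisfies RDP$_2$ if and only if $G$ satisfies RDP$_2$.
   Context: A po-group is a group $G$ (not necessarily Abelian; written here multiplicatively with neutral element $e$) endowed with a partial order $\le$ such that $a\le b$ implies $xay\le xby$ for all $x,y\in G$. Its positive cone is $G^+=\{g\in G: g\ge e\}$. It is linearly ordered if $\le$ is a total order. It is directed if for all $g_1,g_2\in G$ there is $g\in G$ with $g_1,g_2\le g$. Wreath product: for a linearly ordered po-group $A$ and a po-group $G$, both written multiplicatively, $A\,\mathrm{Wr}\,G$ is the set of all pairs $(n,\langle g_a: a\in A\rangle)$ with $n\in A$ and $g_a\in G$ for every $a\in A$, with multiplication $$(n,\langle g_a: a\in A\rangle)*(m,\langle h_a: a\in A\rangle)=(nm,\langle g_a h_{an}: a\in A\rangle)$$ and order $(n,\langle g_a: a\in A\rangle)\le (m,\langle h_a: a\in A\rangle)$ iff $n<m$, or $n=m$ and $g_a\le h_a$ for every $a\in A$. This is a po-group. Riesz decomposition properties of a po-group $G$: RDP: for all $a_1,a_2,b_1,b_2\in G^+$ with $a_1a_2=b_1b_2$ there are $c_{11},c_{12},c_{21},c_{22}\in G^+$ such that $a_1=c_{11}c_{12}$, $a_2=c_{21}c_{22}$, $b_1=c_{11}c_{21}$,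 $b_2=c_{12}c_{22}$. RDP$_1$: as RDP, where in addition the elements can be chosen such that $e\le x\le c_{12}$ and $e\le y\le c_{21}$ imply $xy=yx$. RDP$_2$: as RDP, where in addition the elements can be chosen such that $c_{12}\wedge c_{21}$ exists in $G$ and equals $e$. *)

(* Defs.v *)
From HB Require Import structures.
From mathcomp Require Import all_boot all_order.
From mathcomp Require Import boolp.

Set Implicit Arguments.
Unset Strict Implicit.
Unset Printing Implicit Defensive.

Import Order.TTheory.

Local Open Scope order_scope.
Local Open Scope group_scope.

HB.mixin Record isPOGroup (d : Order.disp_t) G
    of Order.POrder d G & Group G := {
  le_mulg2 : forall a b x y : G, a <= b -> x * a * y <= x * b * y
}.

#[short(type="poGroupType")]
HB.structure Definition POGroup (d : Order.disp_t) :=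
  {G of isPOGroup d G & Order.POrder d G & Group G}.

#[short(type="loGroupType")]
HB.structure Definition LOGroup (d : Order.disp_t) :=
  {G of POGroup d G & Order.Total d G}.

Definition directed (d : Order.disp_t) (G : poGroupType d) : Prop :=
  forall g1 g2 : G, exists g : G, g1 <= g /\ g2 <= g.

Definition is_meet (d : Order.disp_t) (T : porderType d) (x y m : T) : Prop :=
  [/\ m <= x, m <= y & forall z : T, z <= x -> z <= y -> z <= m].

Section RieszDecomposition.
Variables (d : Order.disp_t) (G : poGroupType d).
Implicit Types a b c : G.

Definition refines a1 a2 b1 b2 c11 c12 c21 c22 : Prop :=
  [/\ a1 = c11 * c12, a2 = c21 * c22, b1 = c11 * c21 & b2 = c12 * c22].

(* RDP, where the refining elements can moreover be chosen with [P c12 c21] *)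
Definition RDP_with (P : G -> G -> Prop) : Prop :=
  forall a1 a2 b1 b2 : G,
    1 <= a1 -> 1 <= a2 -> 1 <= b1 -> 1 <= b2 -> a1 * a2 = b1 * b2 ->
  exists c11 c12 c21 c22 : G,
    [/\ [/\ 1 <= c11, 1 <= c12, 1 <= c21 & 1 <= c22],
        refines a1 a2 b1 b2 c11 c12 c21 c22
      & P c12 c21].

Definition RDP : Prop := RDP_with (fun _ _ => True).

Definition RDP1 : Prop :=
  RDP_with (fun c12 c21 => forall x y : G,
    1 <= x <= c12 -> 1 <= y <= c21 -> x * y = y * x).

Definition RDP2 : Prop := RDP_with (fun c12 c21 => is_meet c12 c21 1).

End RieszDecomposition.

Arguments directed {d} G.
Arguments RDP {d} G.
Arguments RDP1 {d} G.
Arguments RDP2 {d} G.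

(* A type alias, so that the pairs do not get the structures of [prod] *)
Definition wreath (d d' : Order.disp_t)
  (A : loGroupType d) (G : poGroupType d') : Type := (A * (A -> G))%type.

Fact wreath_display (d d' : Order.disp_t) : Order.disp_t.
Proof. exact: Order.Disp tt tt. Qed.

Section Wreath.
Variables (d d' : Order.disp_t) (A : loGroupType d) (G : poGroupType d').
Local Notation W := (wreath A G).
Implicit Types u v w : W.

HB.instance Definition _ := Choice.copy W (A * (A -> G))%type.

Definition wreath_one : W := (1, fun=> 1).
Definition wreath_mul u v : W := (u.1 * v.1, fun a => u.2 a * v.2 (a * u.1)).
Definition wreath_inv u : W := (u.1^-1, fun a => (u.2 (a * u.1^-1))^-1).
Definition wreath_le u v : bool :=
  (u.1 < v.1) || (u.1 == v.1) && `[< forall a : A, u.2 a <= v.2 a >].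

Fact wreath_mulA : associative wreath_mul.
Proof.
move=> u v w; congr pair; first exact: mulgA.
by apply/funext => a /=; rewrite !mulgA.
Qed.

Fact wreath_mul1 : left_id wreath_one wreath_mul.
Proof.
case=> n g; congr pair; first exact: mul1g.
by apply/funext => a /=; rewrite mul1g mulg1.
Qed.

Fact wreath_mulr1 : right_id wreath_one wreath_mul.
Proof.
case=> n g; congr pair; first exact: mulg1.
by apply/funext => a /=; rewrite mulg1.
Qed.

Fact wreath_mulV : left_inverse wreath_one wreath_inv wreath_mul.
Proof.
case=> n g; congr pair; first exact: mulVg.
by apply/funext => a /=; rewrite mulVg.
Qed.

Fact wreath_mulrV : right_inverse wreath_one wreath_inv wreath_mul.
Proof.
case=> n g; congr pair; first exact: mulgV.
by apply/funext => a /=; rewrite mulgK mulgV.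
Qed.

HB.instance Definition _ := isGroup.Build W
  wreath_mulA wreath_mul1 wreath_mulr1 wreath_mulV wreath_mulrV.

Fact wreath_le_refl : reflexive wreath_le.
Proof.
by move=> u; rewrite /wreath_le eqxx; apply/orP; right; apply/asboolP.
Qed.

Fact wreath_le_anti : antisymmetric wreath_le.
Proof.
move=> [n g] [m h]; rewrite /wreath_le /= => /andP[].
case/orP=> [ltnm|/andP[/eqP-> /asboolP legh]].
  case/orP=> [ltmn|/andP[/eqP eqmn _]]; last by rewrite eqmn ltxx in ltnm.
  by have := lt_trans ltnm ltmn; rewrite ltxx.
rewrite ltxx eqxx /= => /asboolP lehg; congr pair.
by apply/funext => a; apply/le_anti; rewrite legh lehg.
Qed.

Fact wreath_le_trans : transitive wreath_le.
Proof.
move=> [m h] [n g] [p k]; rewrite /wreath_le /=.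
case/orP=> [ltnm|/andP[/eqP-> /asboolP legh]].
  by case/orP=> [/(lt_trans ltnm)->|/andP[/eqP<- _]] //; rewrite ltnm.
case/orP=> [->//|/andP[-> /asboolP lehk]].
by apply/orP; right; apply/asboolP => a; apply: le_trans (legh a) (lehk a).
Qed.

HB.instance Definition _ := Order.Le_isPOrder.Build (wreath_display d d') W
  wreath_le_refl wreath_le_anti wreath_le_trans.

Fact wreath_le_mulg2 (u v x y : W) : u <= v -> x * u * y <= x * v * y.
Proof.
case: u v x y => [n g] [m h] [p k] [q l].
case/orP=> /= [ltnm|/andP[/eqP/= eqnm /asboolP/= legh]]; apply/orP => /=.
  left; rewrite lt_neqAle le_mulg2 ?(ltW ltnm) // andbT.
  by rewrite (inj_eq (mulIg q)) (inj_eq (mulgI p)) lt_eqF.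
right; rewrite eqnm eqxx; apply/asboolP => a /=.
by apply: le_mulg2.
Qed.

HB.instance Definition _ :=
  isPOGroup.Build (wreath_display d d') W wreath_le_mulg2.

End Wreath.

(* Main.v *)
Require Import Defs.
From mathcomp Require Import all_boot all_order.
From mathcomp Require Import boolp.

(** From the wreath product to [G]: if a product of positive elements has first
coordinate [1], so do its factors; hence a refinement of constant families
consists of families, and evaluating it at [1] gives a refinement in [G].

From [G] to the wreath product: compare the first coordinates of [a1] and [b1].
If they differ, then [a1 < b1] or [b1 < a1], and [c12 = 1] or [c21 = 1] works.
If they agree, then so do those of [a2] and [b2]; directedness gives common
lower bounds that split off on the left of [a1], [b1] and on the right of [a2],
[b2], which leaves positive families to be refined pointwise in [G]. *)

Set Implicit Arguments.
Unset Strict Implicit.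
Unset Printing Implicit Defensive.

Import Order.TTheory.

Local Open Scope order_scope.
Local Open Scope group_scope.

Section POGroupTheory.
Variables (d : Order.disp_t) (G : poGroupType d).
Implicit Types a b x y z : G.

Lemma le_mul2g x a b : (x * a <= x * b) = (a <= b).
Proof.
apply/idP/idP => [/(le_mulg2 _ _ x^-1 1)|/(le_mulg2 _ _ x 1)].
  by rewrite !mulg1 !mulKg.
by rewrite !mulg1.
Qed.

Lemma le_mulg2r x a b : (a * x <= b * x) = (a <= b).
Proof.
apply/idP/idP => [/(le_mulg2 _ _ 1 x^-1)|/(le_mulg2 _ _ 1 x)].
  by rewrite !mul1g !mulgK.
by rewrite !mul1g.
Qed.

Lemma mulVg_ge1 a b : (1 <= a^-1 * b) = (a <= b).
Proof. by rewrite -(le_mul2g a 1) mulg1 mulVKg. Qed.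

Lemma mulgV_ge1 a b : (1 <= b * a^-1) = (a <= b).
Proof. by rewrite -(le_mulg2r a 1) mul1g mulgVK. Qed.

(** Since [1 <= b], one has [a <= a * b = 1], which squeezes [a] to [1]. *)
Lemma mulg_eq1_ge1 a b : 1 <= a -> 1 <= b -> a * b = 1 -> a = 1 /\ b = 1.
Proof.
move=> a1 b1 ab1; have a_eq1 : a = 1.
  by apply/le_anti; rewrite a1 andbT -ab1 -{1}[a]mulg1 le_mul2g b1.
by split=> //; rewrite a_eq1 mul1g in ab1.
Qed.

Lemma le_invg a b : (a^-1 <= b^-1) = (b <= a).
Proof. by rewrite -(mulVg_ge1 a^-1) invgK mulgV_ge1. Qed.

(** Inversion reverses the order, so the inverse of an upper bound of [a^-1] and [b^-1] is a lower
    bound of [a] and [b]. *)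
Lemma directed_lower (dirG : directed G) a b : exists x, x <= a /\ x <= b.
Proof.
by have [x [? ?]] := dirG a^-1 b^-1; exists x^-1; rewrite -(le_invg a) -(le_invg b) invgK.
Qed.

End POGroupTheory.

Section WreathTheory.
Variables (d d' : Order.disp_t) (A : loGroupType d) (G : poGroupType d').
Local Notation W := (wreath A G).
Implicit Types (u v : W) (f g : A -> G) (n : A).

Definition wreath_family f : W := (1, f).

(** Supported at one index, so that being below a positive family is a condition on the value at [1]
    only. *)
Definition wreath_single (x : G) : W :=
  wreath_family (fun a => if a == 1 then x else 1).

Lemma le_wreathP u v :
  reflect (u.1 < v.1 \/ u.1 = v.1 /\ forall a, u.2 a <= v.2 a) (u <= v).
Proof.
apply: (iffP orP) => -[uv|]; [by left| |by left|].
  by case/andP=> /eqP ? /asboolP; right.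
by case=> /eqP-> ?; right; apply/asboolP.
Qed.

Lemma le_wreath_family f g :
  (wreath_family f <= wreath_family g) <-> forall a, f a <= g a.
Proof.
split=> [/le_wreathP[|[]//]|fg]; first by rewrite /= ltxx.
by apply/le_wreathP; right.
Qed.

Lemma wreath_le1 u v : u <= v -> u.1 <= v.1.
Proof. by case/le_wreathP=> [/ltW|[->]]. Qed.

Lemma wreath_ge1P n g :
  reflect (1 < n \/ n = 1 /\ forall a, 1 <= g a) ((1 : W) <= ((n, g) : W)).
Proof.
by apply: (iffP (le_wreathP _ _)) => -[?|[? ?]]; [left|right|left|right].
Qed.

Lemma wreath_familyM f g :
  wreath_family f * wreath_family g = wreath_family (fun a => f a * g a).
Proof.
congr pair; first exact: mulg1.
by apply/funext => a /=; rewrite mulg1.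
Qed.

Lemma wreath_family1 : wreath_family (fun=> 1) = 1.
Proof. by []. Qed.

Lemma wreath_family_between u g :
  1 <= u <= wreath_family g -> u = wreath_family u.2.
Proof.
case: u => n f /andP[/wreath_le1/= n1 /wreath_le1/= ?].
by congr pair; apply/le_anti; rewrite n1 andbT.
Qed.

Lemma wreath_mul_family u v f : 1 <= u -> 1 <= v ->
  wreath_family f = u * v -> exists g h, u = wreath_family g /\ v = wreath_family h.
Proof.
case: u v => [n g] [m h] /wreath_le1/= n1 /wreath_le1/= m1 [/esym nm _].
by have [-> ->] := mulg_eq1_ge1 n1 m1 nm; exists g, h.
Qed.

Lemma wreath_single_le x f :
  (forall a, 1 <= f a) -> x <= f 1 -> wreath_single x <= wreath_family f.
Proof.
by move=> f1 xf; apply/le_wreath_family => a; case: eqP => [->|_].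
Qed.

Lemma wreath_single_ge1 x : 1 <= x -> 1 <= wreath_single x.
Proof.
by move=> x1; rewrite -wreath_family1; apply/le_wreath_family => a; case: eqP.
Qed.

(** Treats the three properties at once: what is left for each is to transfer its side condition
    from positive families to their values at [1]. *)
Lemma RDP_with_of_wreath (P : W -> W -> Prop) (Q : G -> G -> Prop) :
  (forall f g, (forall a, 1 <= f a) -> (forall a, 1 <= g a) ->
     P (wreath_family f) (wreath_family g) -> Q (f 1) (g 1)) ->
  RDP_with P -> RDP_with Q.
Proof.
move=> PQ rdpW a1 a2 b1 b2 a1_ge1 a2_ge1 b1_ge1 b2_ge1 ab.
pose eval1 (u : W) := u.2 1; pose k x := wreath_family (fun=> x).
have k_ge1 x : 1 <= x -> 1 <= k x.
  by move=> x1; rewrite -wreath_family1; apply/le_wreath_family.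
have kab : k a1 * k a2 = k b1 * k b2 by rewrite !wreath_familyM ab.
have [c11 [c12 [c21 [c22 [[]]]]]] :=
  rdpW _ _ _ _ (k_ge1 _ a1_ge1) (k_ge1 _ a2_ge1)
               (k_ge1 _ b1_ge1) (k_ge1 _ b2_ge1) kab.
move=> p11 p12 p21 p22 [e1 e2 e3 e4].
have [f11 [f12 [E11 E12]]] := wreath_mul_family p11 p12 e1.
have [f21 [f22 [E21 E22]]] := wreath_mul_family p21 p22 e2.
move: p11 p12 p21 p22 e1 e2 e3 e4; rewrite {}E11 {}E12 {}E21 {}E22.
rewrite !wreath_familyM -!wreath_family1.
move=> /le_wreath_family p11 /le_wreath_family p12.
move=> /le_wreath_family p21 /le_wreath_family p22.
move=> /(congr1 eval1) e1 /(congr1 eval1) e2.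
move=> /(congr1 eval1) e3 /(congr1 eval1) e4 Pc.
by exists (f11 1), (f12 1), (f21 1), (f22 1); split; last exact: PQ Pc.
Qed.

(** The last clause keeps the element positive when its family is replaced by [l * c] or [c * l]
    with [c] positive: if [1 < n], any family will do; if [n = 1], both families are positive and
    [l] can be trivial. *)
Lemma wreath_lower (dirG : directed G) n f g :
  (1 : W) <= ((n, f) : W) -> (1 : W) <= ((n, g) : W) ->
  exists l : A -> G, [/\ forall a, l a <= f a, forall a, l a <= g a
    & 1 < n \/ n = 1 /\ forall a, l a = 1].
Proof.
case/wreath_ge1P=> [n1 _|[-> f1]]; last first.
  case/wreath_ge1P=> [|[_ g1]]; first by rewrite ltxx.
  by exists (fun=> 1); split=> //; right.
have /choice[l lP] a : exists x, x <= f a /\ x <= g a by exact: directed_lower.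
by exists l; split=> [a|a|]; [case: (lP a)|case: (lP a)|left].
Qed.

(** The three conditions on [P] match the outcomes of comparing [u1.1] with [v1.1]: [c12 = 1],
    [c21 = 1], or two families. *)
Lemma RDP_with_wreath (dirG : directed G)
    (P : W -> W -> Prop) (Q : G -> G -> Prop) :
  (forall u, 1 <= u -> P 1 u) -> (forall u, 1 <= u -> P u 1) ->
  (forall f g, (forall a, Q (f a) (g a)) ->
     P (wreath_family f) (wreath_family g)) ->
  RDP_with Q -> RDP_with P.
Proof.
move=> P1u Pu1 QP rdpG u1 u2 v1 v2 u1_ge1 u2_ge1 v1_ge1 v2_ge1 uv.
have [lt_uv|lt_vu|eq_uv] := ltgtP u1.1 v1.1.
- have le_uv : 1 <= u1^-1 * v1.
    by rewrite mulVg_ge1; apply/le_wreathP; left.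
  exists u1, 1, (u1^-1 * v1), v2; split=> //; last exact: P1u.
  by split; rewrite ?mulg1 ?mul1g ?mulVKg // -mulgA -uv mulKg.
- have le_vu : 1 <= v1^-1 * u1.
    by rewrite mulVg_ge1; apply/le_wreathP; left.
  exists v1, (v1^-1 * u1), 1, u2; split=> //; last exact: Pu1.
  by split; rewrite ?mulg1 ?mul1g ?mulVKg // -mulgA uv mulKg.
move: u1 u2 v1 v2 u1_ge1 u2_ge1 v1_ge1 v2_ge1 uv eq_uv.
move=> [n f1] [m f2] [n' g1] [m' g2] f1_ge1 f2_ge1 g1_ge1 g2_ge1 uv /= eqn.
move: g1_ge1 uv; rewrite -{}eqn => {n'}g1_ge1 uv.
have /mulgI eqm : n * m = n * m' := congr1 fst uv.
have fg a : f1 a * f2 (a * n) = g1 a * g2 (a * n) := congr1 (fun u : W => u.2 a) uv.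
move: g2_ge1; rewrite -eqm => {m' eqm uv}g2_ge1.
have [l [lf lg l_n]] := wreath_lower dirG f1_ge1 g1_ge1.
have [r [rf rg r_m]] := wreath_lower dirG f2_ge1 g2_ge1.
(* The index [a * n] is the shift made by the product, so cancelling [l a] on the left and
   [r (a * n)] on the right leaves equal products. *)
have /choice[c cP] a : exists c : G * G * (G * G),
    [/\ [/\ 1 <= c.1.1, 1 <= c.1.2, 1 <= c.2.1 & 1 <= c.2.2],
        refines ((l a)^-1 * f1 a) (f2 (a * n) * (r (a * n))^-1)
                ((l a)^-1 * g1 a) (g2 (a * n) * (r (a * n))^-1)
                c.1.1 c.1.2 c.2.1 c.2.2
      & Q c.1.2 c.2.1].
  have [|||||c11 [c12 [c21 [c22 ?]]]] := rdpG
    ((l a)^-1 * f1 a) (f2 (a * n) * (r (a * n))^-1)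
    ((l a)^-1 * g1 a) (g2 (a * n) * (r (a * n))^-1).
  + by rewrite mulVg_ge1.
  + by rewrite mulgV_ge1.
  + by rewrite mulVg_ge1.
  + by rewrite mulgV_ge1.
  + by rewrite !mulgA -!(mulgA (l a)^-1) fg.
  by exists (c11, c12, (c21, c22)).
(* The first coordinates [n] and [m] go entirely to [c11] and [c22]. A product with [c11] on the
   left shifts the right factor by [n]; the index [a / n] undoes this. *)
exists (n, fun a => l a * (c a).1.1), (wreath_family (fun a => (c (a / n)).1.2)),
  (wreath_family (fun a => (c (a / n)).2.1)),
  (m, fun a => (c (a / n)).2.2 * r a); split.
- split.
  + apply/wreath_ge1P; case: l_n => [|[-> l1]]; [by left|right].
    by split=> // a; rewrite l1 mul1g; case: (cP a) => -[].
  + by rewrite -wreath_family1; apply/le_wreath_family => a; case: (cP (a / n)) => -[].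
  + by rewrite -wreath_family1; apply/le_wreath_family => a; case: (cP (a / n)) => -[].
  + apply/wreath_ge1P; case: r_m => [|[-> r1]]; [by left|right].
    by split=> // a; rewrite r1 mulg1; case: (cP (a / n)) => -[].
- split; congr pair; rewrite ?mulg1 ?mul1g //; apply/funext => a /=.
  + by rewrite mulgK -mulgA; case: (cP a) => _ [<- _ _ _] _; rewrite mulVKg.
  + rewrite mulg1 mulgA; case: (cP (a / n)) => _ [_ <- _ _] _.
    by rewrite !mulgVK.
  + by rewrite mulgK -mulgA; case: (cP a) => _ [_ _ <- _] _; rewrite mulVKg.
  + rewrite mulg1 mulgA; case: (cP (a / n)) => _ [_ _ _ <-] _.
    by rewrite !mulgVK.
- by apply: QP => a; case: (cP (a / n)).
Qed.

End WreathTheory.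

Theorem theorem4p1 (d d' : Order.disp_t)
    (A : loGroupType d) (G : poGroupType d') (dirG : directed G) :
  [/\ RDP (wreath A G) <-> RDP G,
      RDP1 (wreath A G) <-> RDP1 G
    & RDP2 (wreath A G) <-> RDP2 G].
Proof.
split; split.
- exact: RDP_with_of_wreath.
- exact: RDP_with_wreath.
- apply: RDP_with_of_wreath => f g f1 g1 comm x y /andP[x1 xf] /andP[y1 yg].
  have := comm (wreath_single A x) (wreath_single A y).
  rewrite !wreath_single_ge1 // !wreath_single_le // !wreath_familyM.
  by case/(_ isT isT)=> /(congr1 (@^~ 1)); rewrite eqxx.
- apply: RDP_with_wreath => // [u _ x y|u _ x y|f g comm x y].
  + by move/le_anti<- => _; rewrite mul1g mulg1.
  + by move=> _ /le_anti<-; rewrite mul1g mulg1.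
  (* Both [x] and [y] have first coordinate [1], so they are families and commute index by index. *)
  + move=> xf yg; move: (xf) (yg).
    rewrite (wreath_family_between xf) (wreath_family_between yg).
    rewrite !wreath_familyM -!wreath_family1.
    move=> /andP[/le_wreath_family x1 /le_wreath_family xf'].
    move=> /andP[/le_wreath_family y1 /le_wreath_family yg'].
    congr pair; apply/funext => a.
    by apply: comm; apply/andP; split=> /=; [exact: x1|exact: xf'|exact: y1|exact: yg'].
- apply: RDP_with_of_wreath => f g f1 g1 [_ _ meet1]; split=> // z zf zg.
  (* Here [z] need not be positive: away from [1] the value is [1], which lies below [f] and [g]. *)
  have := meet1 (wreath_single A z) (wreath_single_le f1 zf) (wreath_single_le g1 zg).
  by rewrite -wreath_family1 => /le_wreath_family/(_ 1); rewrite eqxx.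
- apply: RDP_with_wreath => // f g meet1.
  split; try by rewrite -wreath_family1; apply/le_wreath_family => a; case: (meet1 a).
  (* A lower bound with first coordinate below [1] is already below the neutral element; any other
     is a family, bounded at each index by the meet in [G]. *)
  move=> z /le_wreathP[?|[z1 zf]]; first by move=> _; apply/le_wreathP; left.
  move=> /le_wreathP[?|[_ zg]]; first by apply/le_wreathP; left.
  apply/le_wreathP; right; split=> // a.
  by case: (meet1 a) => _ _; apply.
Qed.
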